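(* Let $m\in\mathbb{N}$, $\theta_0\in\mathbb{R}$, $\psi_0\in\mathbb{R}$ and $\mu_0\in\mathbb{R}^m$. Let $\mathcal{A}$ be a model for an OFFO method satisfying Conditions A and B of the context (Condition B with these initial values), and let $\{d'_k : k+1\in\mathbb{N}\}$ be a sequence as provided by Condition B. Then there exists a differentiable function $F:\mathbb{R}\to\mathbb{R}$ that is continuous and bounded below, and whose derivative $\dot F$ is locally Lipschitz continuous, such that the sequence $\{(\theta_k,\psi_k,\mu_k): k+1\in\mathbb{N}\}$ defined from the initial values $(\theta_0,\psi_0,\mu_0)$ by $$(\theta_{k+1},\psi_{k+1},\mu_{k+1})=\mathcal{A}\big(k,\theta_k,\psi_k,\mu_k,\dot F(\psi_k)\big),\qquad k=0,1,2,\ldots,$$ satisfies $$\liminf_{k\to\infty}F(\theta_k)=\infty\qquad\text{and}\qquad \liminf_{k\to\infty}|d'_k|\le\liminf_{k\to\infty}|\dot F(\theta_k)|.$$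
   Context: A model for an OFFO (objective-function-free optimization) method in one dimension is a map $\mathcal{A}:\{0,1,2,\ldots\}\times\mathbb{R}\times\mathbb{R}\times\mathbb{R}^m\times\mathbb{R}\to\mathbb{R}\times\mathbb{R}\times\mathbb{R}^m$, written $\mathcal{A}(k,\theta,\psi,\mu,d)=(\theta_+,\psi_+,\mu_+)$, where $k$ is the iteration counter, $\theta$ the current iterate, $\psi$ an ancillary iterate, $\mu$ a vector of state variables, and $d$ gradient information; $\theta_+,\psi_+,\mu_+$ are the updated quantities. Condition A. For all $\theta\in\mathbb{R}$, $\psi\in\mathbb{R}$, $\mu\in\mathbb{R}^m$, $k\in\{0,1,2,\ldots\}$, and all functions $H_1,H_2:\mathbb{R}\to\mathbb{R}$ with $H_1(\psi)=H_2(\psi)$, one has $\mathcal{A}(k,\theta,\psi,\mu,H_1(\psi))=\mathcal{A}(k,\theta,\psi,\mu,H_2(\psi))$. Condition B (for the initial values $\theta_0,\psi_0,\mu_0$). There exists a sequence $\{d'_k: k+1\in\mathbb{N}\}\subset\mathbb{R}$ for which the sequence $\{(\theta_k,\psi_k,\mu_k):k+1\in\mathbb{N}\}$ defined by $(\theta_{k+1},\psi_{k+1},\mu_{k+1})=\mathcal{A}(k,\theta_k,\psi_k,\mu_k,d'_k)$ has the property that $\{\theta_k\}$ and $\{\psi_k\}$ are both unbounded, strictly increasing sequences. A function $G$ is locally Lipschitz continuous if every point has an open ball around it on which $G$ is Lipschitz continuous. *)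

(* Defs.v *)
From mathcomp Require Import all_boot all_order all_algebra.
From mathcomp Require Import all_classical all_reals all_analysis.
Set Implicit Arguments.
Unset Strict Implicit.
Unset Printing Implicit Defensive.
Import Order.TTheory GRing.Theory Num.Theory.
Import numFieldNormedType.Exports.
Local Open Scope classical_set_scope.
Local Open Scope ring_scope.

Record offo_state (R : realType) (m : nat) := OffoState {
  iterate : R;
  ancillary : R;
  state_vars : 'rV[R]_m
}.

(* [A k theta psi mu d]: counter, iterate, ancillary iterate, state variables,
   gradient information; the value is the updated triple. *)
Definition offo_model (R : realType) (m : nat) :=
  nat -> R -> R -> 'rV[R]_m -> R -> offo_state R m.

Definition condition_A (R : realType) (m : nat) (A : offo_model R m) : Prop :=
  forall (theta psi : R) (mu : 'rV[R]_m) (k : nat) (H1 H2 : R -> R),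
    H1 psi = H2 psi -> A k theta psi mu (H1 psi) = A k theta psi mu (H2 psi).

(* The gradient information fed to step [k] may depend on [k] and on the
   current ancillary iterate: [g k psi := d' k] gives a prescribed sequence,
   [g k psi := F^`()%classic psi] the derivative at the ancillary iterate. *)
Fixpoint offo_seq (R : realType) (m : nat) (A : offo_model R m)
    (s0 : offo_state R m) (g : nat -> R -> R) (k : nat) : offo_state R m :=
  if k is k'.+1 then
    let s := offo_seq A s0 g k' in
    A k' (iterate s) (ancillary s) (state_vars s) (g k' (ancillary s))
  else s0.

(* [increasing_seq u] is [{mono u : i j / i <= j}], i.e. [u] is strictly
   increasing. *)
Definition condition_B_witness (R : realType) (m : nat) (A : offo_model R m)
    (theta0 psi0 : R) (mu0 : 'rV[R]_m) (d' : nat -> R) : Prop :=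
  let s := offo_seq A (OffoState theta0 psi0 mu0) (fun k _ => d' k) in
  let theta k := iterate (s k) in
  let psi k := ancillary (s k) in
  [/\ increasing_seq theta, ~ bounded_set (range theta),
      increasing_seq psi & ~ bounded_set (range psi)].

Definition condition_B (R : realType) (m : nat) (A : offo_model R m)
    (theta0 psi0 : R) (mu0 : 'rV[R]_m) : Prop :=
  exists d' : nat -> R, condition_B_witness A theta0 psi0 mu0 d'.

Definition locally_lipschitz (R : realType) (G : R -> R) : Prop :=
  forall x : R, exists2 r : R, 0 < r & [lipschitz G t | t in ball x r].

(* Main.v *)
(** The prescribed slopes [d' k] at the [psi k] force the method to reproduce the
sequence of Condition B.  The points [theta k] and [psi k] together form a
locally finite set, so [F] can be a sum of nonnegative C^{1,1} bumps whose
supports are small enough to contain in their interior only their own centre: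
the bump at [p] fixes the value of [F] at [p] (taken [>= p]) and the slope there,
namely [d' j] if [p = psi j], and [d' k] if [p = theta k] is not among the
[psi j].  When [theta k = psi j] the indices [j] tend to infinity with [k], which
gives the comparison of the lower limits. *)
Require Import Defs.
From mathcomp Require Import all_boot all_order all_algebra.
From mathcomp Require Import all_classical all_reals all_analysis.
From mathcomp Require Import ring lra.
Set Implicit Arguments.
Unset Strict Implicit.
Unset Printing Implicit Defensive.

Import Order.TTheory GRing.Theory Num.Theory.
Import numFieldNormedType.Exports.
Local Open Scope classical_set_scope.
Local Open Scope ring_scope.

(** * Calculus of locally Lipschitz functions *)

(** The library notion asks for the inequality for all large constants; a single explicit
    nonnegative constant is easier to compute with. *)
Lemma locally_lipschitzP (R : realType) (G : R -> R) :
  locally_lipschitz G <->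
  forall x, exists2 r, 0 < r & exists2 k, 0 <= k &
    forall y z, `|x - y| < r -> `|x - z| < r -> `|G y - G z| <= k * `|y - z|.
Proof.
split=> G_lip x; have [r r0 Gr] := G_lip x; exists r => //.
- case: Gr => M [_ GM]; exists (`|M| + 1); first by rewrite addr_ge0.
  move=> y z xy xz; apply: (GM (`|M| + 1) _ (y, z)); last by split.
  by rewrite (le_lt_trans (ler_norm M))// ltrDl.
- case: Gr => k k0 Gk; exists k; split; first exact: num_real.
  move=> M kM [y z] [/= xy xz]; rewrite (le_trans (Gk _ _ xy xz))//.
  by rewrite ler_wpM2r// ltW.
Qed.

Lemma locally_lipschitz_local (R : realType) (F : R -> R) :
  (forall x, exists2 r, 0 < r & exists2 G, locally_lipschitz G &
     forall y, `|x - y| < r -> F y = G y) -> locally_lipschitz F.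
Proof.
move=> FG; apply/locally_lipschitzP => x.
have [r r0 [G /locally_lipschitzP/(_ x)[s s0 [k k0 Gk]] FGr]] := FG x.
exists (Num.min r s); first by rewrite lt_min r0.
exists k => // y z; rewrite !lt_min => /andP[yr ys] /andP[zr zs].
by rewrite !FGr//; exact: Gk.
Qed.

Lemma locally_lipschitz_cst (R : realType) (c : R) :
  locally_lipschitz (fun=> c).
Proof.
apply/locally_lipschitzP => x; exists 1 => //; exists 0 => // y z _ _.
by rewrite subrr normr0 mul0r.
Qed.

Lemma locally_lipschitz_id (R : realType) : locally_lipschitz (@id R).
Proof.
apply/locally_lipschitzP => x; exists 1 => //; exists 1 => // y z _ _.
by rewrite mul1r.
Qed.

Lemma locally_lipschitzD (R : realType) (F G : R -> R) :
  locally_lipschitz F -> locally_lipschitz G ->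
  locally_lipschitz (fun x => F x + G x).
Proof.
move=> /locally_lipschitzP Fl /locally_lipschitzP Gl.
apply/locally_lipschitzP => x.
have [r r0 [k k0 Fk]] := Fl x; have [s s0 [l l0 Gl']] := Gl x.
exists (Num.min r s); first by rewrite lt_min r0.
exists (k + l); first exact: addr_ge0.
move=> y z; rewrite !lt_min => /andP[yr ys] /andP[zr zs].
rewrite mulrDl opprD addrACA (le_trans (ler_normD _ _))// lerD//.
  exact: Fk.
exact: Gl'.
Qed.

Lemma locally_lipschitzM (R : realType) (F G : R -> R) :
  locally_lipschitz F -> locally_lipschitz G ->
  locally_lipschitz (fun x => F x * G x).
Proof.
move=> /locally_lipschitzP Fl /locally_lipschitzP Gl.
apply/locally_lipschitzP => x.
have [r r0 [k k0 Fk]] := Fl x; have [s s0 [l l0 Gl']] := Gl x.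
(* A Lipschitz function is bounded on a ball; [a] and [b] below bound the two factors near [x]. *)
have bounded (H : R -> R) q m : 0 < q -> 0 <= m ->
    (forall y z, `|x - y| < q -> `|x - z| < q ->
       `|H y - H z| <= m * `|y - z|) ->
    forall y, `|x - y| < q -> `|H y| <= `|H x| + m * q.
  move=> q0 m0 Hm y xy; rewrite -[H y](subKr (H x)).
  rewrite (le_trans (ler_normB _ _))// lerD2l.
  rewrite (le_trans (Hm x y _ xy)) ?subrr ?normr0//.
  by rewrite ler_wpM2l// ltW.
have Fb := bounded F _ _ r0 k0 Fk; have Gb := bounded G _ _ s0 l0 Gl'.
set a := `|F x| + _ in Fb; set b := `|G x| + _ in Gb.
have a0 : 0 <= a by rewrite addr_ge0// mulr_ge0// ltW.
have b0 : 0 <= b by rewrite addr_ge0// mulr_ge0// ltW.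
exists (Num.min r s); first by rewrite lt_min r0.
exists (a * l + k * b); first by rewrite addr_ge0// mulr_ge0.
move=> y z; rewrite !lt_min => /andP[yr ys] /andP[zr zs].
rewrite (_ : _ - _ = F y * (G y - G z) + (F y - F z) * G z); last by ring.
rewrite (le_trans (ler_normD _ _))// !normrM mulrDl lerD//.
  by rewrite -mulrA ler_pM// ?Fb// Gl'.
by rewrite mulrAC ler_pM// ?Gb// Fk.
Qed.

Lemma locally_lipschitz_max0 (R : realType) (F : R -> R) :
  locally_lipschitz F -> locally_lipschitz (fun x => Num.max 0 (F x)).
Proof.
move=> /locally_lipschitzP Fl; apply/locally_lipschitzP => x.
have [r r0 [k k0 Fk]] := Fl x; exists r => //; exists k => // y z xy xz.
rewrite (le_trans _ (Fk y z xy xz))// ler_norml.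
have /[!ler_norml]/andP[le1 le2] := lexx `|F y - F z|.
have := normr_ge0 (F y - F z).
by case: (leP 0 (F y)) => ?; case: (leP 0 (F z)) => ? ?; apply/andP; split; lra.
Qed.

Lemma locally_lipschitz_sum (R : realType) (f : nat -> R -> R) N :
  (forall n, locally_lipschitz (f n)) ->
  locally_lipschitz (fun x => \sum_(n < N) f n x).
Proof.
move=> fl; elim: N => [|N IHN].
  rewrite (_ : (fun _ => _) = fun=> 0); first exact: locally_lipschitz_cst.
  by apply/funext => x; rewrite big_ord0.
rewrite (_ : (fun _ => _) = fun x => \sum_(n < N) f n x + f N x).
  exact: locally_lipschitzD.
by apply/funext => x; rewrite big_ord_recr.
Qed.

(** * Bump functions with locally Lipschitz derivative *)

Lemma is_derive_sqr_max0 (R : realType) (s : R) :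
  is_derive s 1 (fun x => Num.max 0 x ^+ 2) (2 * Num.max 0 s).
Proof.
suff cvg_s : (fun h : R => h^-1 *: (((fun x => Num.max 0 x ^+ 2) \o shift s)
    (h *: 1) - Num.max 0 s ^+ 2)) @ 0^' --> 2 * Num.max 0 s.
  split; first by apply/cvg_ex; exists (2 * Num.max 0 s).
  exact: cvg_lim cvg_s.
apply/cvgrPdist_le => e e0; near=> h.
have h0 : h != 0 by near: h; exact: nbhs_dnbhs_neq.
have he : `|h| <= e by near: h; exact: dnbhs0_le.
rewrite /= [h *: 1]mulr1.
(* Multiplied by [h], the error of the difference quotient is a first-order Taylor remainder, which
   is at most [h ^+ 2] in absolute value. *)
have -> : 2 * Num.max 0 s - h^-1 *: (Num.max 0 (h + s) ^+ 2 - Num.max 0 s ^+ 2)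
    = - (h^-1 * (Num.max 0 (h + s) ^+ 2 - Num.max 0 s ^+ 2
                 - 2 * Num.max 0 s * h)).
  by rewrite /GRing.scale /=; field.
rewrite normrN normrM normfV ler_pdivrMl ?normr_gt0//.
apply: le_trans (ler_wpM2l (normr_ge0 h) he); rewrite -normrM -expr2.
rewrite [leRHS]ger0_norm ?sqr_ge0//.
by rewrite ler_norml; case: (leP 0 (h + s)) => ?; case: (leP 0 s) => ?;
  apply/andP; split; nra.
Unshelve. all: by end_near. Qed.

(** The affine function with value [c] and slope [v] at [p] is multiplied by the square of the
    positive part of [1 - ((x - p) / r) ^+ 2]. This cutoff has value 1 and slope 0 at [p], and
    squaring it makes the derivative locally Lipschitz. The bound on [|v| * r] keeps the affine
    factor nonnegative on the support. *)
Lemma exists_bump (R : realType) (p c v r : R) : 0 < r -> `|v| * r <= c ->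
  exists f : (R -> R) * (R -> R),
  [/\ (forall x : R, is_derive x 1 f.1 (f.2 x)), locally_lipschitz f.2,
      (forall x, 0 <= f.1 x), f.1 p = c /\ f.2 p = v &
      forall x, r <= `|x - p| -> f.1 x = 0 /\ f.2 x = 0].
Proof.
move=> r0 vrc; pose w := r^-1 ^+ 2; have wr : w * r ^+ 2 = 1.
  by rewrite /w -exprMn mulVf ?expr1n// gt_eqF.
have w0 : 0 < w by rewrite exprn_gt0// invr_gt0.
pose q x := 1 - w * (x - p) ^+ 2; pose s x := Num.max 0 (q x).
exists (fun x => (c + v * (x - p)) * s x ^+ 2,
        fun x => v * s x ^+ 2 +
          (c + v * (x - p)) * (2 * s x * (- (2 * w * (x - p))))).
split=> /=.
- move=> x.
  have dq : is_derive x 1 q (- (2 * w * (x - p))).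
    rewrite /q; apply: is_derive_eq.
    by rewrite /GRing.scale /=; ring.
  have ds := is_derive1_comp (is_derive_sqr_max0 (q x)) dq.
  have dl : is_derive x 1 (fun x => c + v * (x - p)) v.
    by apply: is_derive_eq; rewrite /GRing.scale /=; ring.
  apply: is_derive_eq (is_deriveM dl ds) _.
  by rewrite /GRing.scale /= /s; ring.
- have lx : locally_lipschitz (fun x => x - p).
    apply: locally_lipschitzD; first exact: locally_lipschitz_id.
    exact: locally_lipschitz_cst.
  have ls : locally_lipschitz s.
    apply: locally_lipschitz_max0.
    rewrite (_ : q = fun x => 1 + (- w) * ((x - p) * (x - p))).
      apply: locally_lipschitzD; first exact: locally_lipschitz_cst.
      apply: locally_lipschitzM; first exact: locally_lipschitz_cst.
      exact: locally_lipschitzM.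
    by apply/funext => x; rewrite /q; ring.
  rewrite (_ : (fun _ => _) = fun x => v * (s x * s x) +
      (c + v * (x - p)) * (s x * ((- (4 * w)) * (x - p)))); last first.
    by apply/funext => x; ring.
  do ?[exact: lx | exact: ls | exact: locally_lipschitz_cst |
       apply: locally_lipschitzD | apply: locally_lipschitzM].
- move=> x; rewrite /s; case: (leP 0 (q x)) => [|_]; last first.
    by rewrite expr0n mulr0.
  rewrite /q subr_ge0 => xp; rewrite mulr_ge0 ?sqr_ge0//.
  have xr : `|x - p| <= r.
    rewrite -ler_sqr ?nnegrE ?(ltW r0)// real_normK ?num_real//.
    by rewrite -(ler_pM2l w0) wr.
  have : `|v * (x - p)| <= c.
    by apply: le_trans vrc; rewrite normrM ler_wpM2l.
  by rewrite ler_norml => /andP[]; lra.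
- rewrite /s /q subrr expr0n !mulr0 subr0 addr0 oppr0 !mulr0 addr0.
  by rewrite maxEle ler01 expr1n !mulr1.
- move=> x rx; rewrite (_ : s x = 0) ?expr0n/= ?mulr0 ?mul0r ?mulr0 ?addr0//.
  rewrite /s maxEle /q; case: ifP => // q0; apply/eqP; rewrite eq_le {}q0 andbT.
  rewrite subr_le0 -wr ler_pM2l// -(real_normK (num_real (x - p))).
  by rewrite ler_sqr ?nnegrE// ltW.
Qed.

(** * Locally finite sums of bumps and interpolation *)

Lemma eq_sum_ord_eq0_tail (V : nmodType) (u : nat -> V) N K :
  (forall n, (N <= n)%N -> u n = 0) -> (forall n, (K <= n)%N -> u n = 0) ->
  \sum_(n < N) u n = \sum_(n < K) u n.
Proof.
wlog NK : N K / (N <= K)%N.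
  by move=> H uN uK; case: (leqP N K) => [|/ltnW] ?; [|symmetry]; exact: H.
move=> u0 _; rewrite -(subnKC NK); elim: (K - N)%N => [|j IHj].
  by rewrite addn0.
by rewrite addnS big_ord_recr /= -IHj u0 ?addr0// leq_addr.
Qed.

(** Only finitely many terms are at most [p n + 1], so [r] is the minimum of 1 and finitely many
    positive distances. Repeated values are allowed, since a [theta k] may equal a [psi j]. *)
Lemma divergent_separated (R : realType) (p : nat -> R) : p @ \oo --> +oo ->
  forall n, exists2 r, 0 < r <= 1 & forall m, p m = p n \/ r <= `|p m - p n|.
Proof.
move=> /cvgryPgt py n; have [N _ Np] := py (p n + 1).
suff [r r01 rP] : exists2 r, 0 < r <= 1 &
    forall m, (m < N)%N -> p m = p n \/ r <= `|p m - p n|.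
  exists r => // m; have [/rP//|Nm] := ltnP m N; right.
  have /= pm := Np _ Nm; case/andP: r01 => _ r1.
  by rewrite (le_trans r1)// ler_normr lerBrDl ltW.
elim: N {Np} => [|N [r /andP[r0 r1] rP]]; first by exists 1; rewrite ?ltr01/=.
have [pNn|pNn] := eqVneq (p N) (p n).
  exists r; rewrite ?r0// => m; rewrite ltnS leq_eqVlt => /predU1P[->|/rP//].
  by left.
exists (Num.min r `|p N - p n|).
  by rewrite lt_min r0 normr_gt0 subr_eq0 pNn/= ge_min r1.
move=> m; rewrite ltnS leq_eqVlt => /predU1P[->|/rP[|rm]]; [right|by left|right].
  by rewrite ge_min lexx orbT.
by rewrite ge_min rm.
Qed.

(** The slope [v] is a function of the point, not of the index, so that repetitions in [p] make
    consistent demands. *)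
Lemma exists_smooth_interpolation (R : realType) (p : nat -> R) (v : R -> R) :
  p @ \oo --> +oo ->
  exists F : R -> R,
    [/\ (forall x, derivable F x 1), locally_lipschitz F^`()%classic,
        (forall x, 0 <= F x), (forall n, p n <= F (p n)) &
        forall n, F^`()%classic (p n) = v (p n)].
Proof.
move=> py; have /choice[r rP] : forall n, exists r : R, 0 < r <= 1 /\
    forall m, p m = p n \/ r <= `|p m - p n|.
  by move=> n; have [r ? ?] := divergent_separated py n; exists r.
(* Only the first occurrence of each value of [p] carries a bump. *)
pose new n := [forall m : 'I_n, p m != p n].
pose slope n : R := if new n then v (p n) else 0.
(* The first summand gives [p n <= F (p n)]; the second gives the condition of [exists_bump], as the
   radii are at most 1. *)
pose height n : R := if new n then `|p n| + `|v (p n)| else 0.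
have /choice[f fP] : forall n, exists f : (R -> R) * (R -> R),
    [/\ (forall x : R, is_derive x 1 f.1 (f.2 x)), locally_lipschitz f.2,
      (forall x, 0 <= f.1 x), f.1 (p n) = height n /\ f.2 (p n) = slope n &
      forall x, r n <= `|x - p n| -> f.1 x = 0 /\ f.2 x = 0].
  move=> n; have [/andP[r0 r1] _] := rP n; apply: exists_bump => //.
  rewrite /slope /height; case: ifP => _; last by rewrite normr0 mul0r.
  by rewrite (le_trans (ler_piMr _ r1))// lerDr.
(* The margin 1 exceeds no radius by less than 0: from index [N b] on, all bumps vanish on the
   half-line up to [b]. *)
have /choice[N NP] : forall b : R, exists N, forall n, (N <= n)%N -> b + 1 < p n.
  move=> b; have /cvgryPgt/(_ (b + 1))[N _ pN] := py.
  by exists N => n; exact: pN.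
have f0 (b : R) n (y : R) : (N b <= n)%N -> y <= b -> (f n).1 y = 0 /\ (f n).2 y = 0.
  move=> Nn yb; have [_ _ _ _] := fP n; apply.
  have [/andP[_ rn1] _] := rP n; have := NP _ _ Nn => bpn.
  by rewrite (le_trans rn1)// distrC ler_normr; apply/orP; left; lra.
pose F (y : R) := \sum_(n < N y) (f n).1 y; pose G (y : R) := \sum_(n < N y) (f n).2 y.
have FGE (b y : R) : y <= b ->
    F y = \sum_(n < N b) (f n).1 y /\ G y = \sum_(n < N b) (f n).2 y.
  move=> yb; split.
    apply: (eq_sum_ord_eq0_tail (u := fun n => (f n).1 y)) => n Nn.
      exact: (f0 _ _ _ Nn (lexx y)).1.
    exact: (f0 _ _ _ Nn yb).1.
  apply: (eq_sum_ord_eq0_tail (u := fun n => (f n).2 y)) => n Nn.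
    exact: (f0 _ _ _ Nn (lexx y)).2.
  exact: (f0 _ _ _ Nn yb).2.
(* The truncation [N y] varies with [y], but on the unit ball around [x] the fixed truncation
   [N (x + 1)] gives the same sum. *)
have dF (x : R) : is_derive x 1 F (G x).
  have [_ ->] := FGE (x + 1) x (ltW (ltr_pwDr ltr01 (lexx x))).
  apply: (@near_eq_is_derive _ _ _ (\sum_(n < N (x + 1)) (f n).1)).
    exists 1 => //= y; rewrite /= ltr_norml => /andP[xy _].
    have yx : y <= x + 1 by lra.
    by have [-> _] := FGE _ _ yx; rewrite fct_sumE.
  by apply: is_derive_sum => n; have [] := fP n.
have FG : F^`()%classic = G.
  by apply/funext => x; rewrite derive1E derive_val.
have value m : exists i,
    [/\ p i = p m, F (p m) = height i, G (p m) = slope i & new i].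
  have [i /eqP pim i_min] : exists2 i, p i == p m &
      forall j, p j == p m -> (i <= j)%N.
    have ex : exists i, p i == p m by exists m.
    by exists (ex_minn ex); case: ex_minnP.
  have newi : new i.
    apply/forallP => j; rewrite pim; apply/negP => /i_min.
    by rewrite leqNgt ltn_ord.
  have iN : (i < N (p m))%N.
    rewrite ltnNge; apply/negP => /NP; rewrite pim ltNge => /negP; apply.
    by rewrite lerDl.
  (* A bump with another centre vanishes at [p m] by the choice of radii; one with the same centre
     and index other than [i] is a repetition, with height and slope 0. *)
  have f_other n : n != i -> (f n).1 (p m) = 0 /\ (f n).2 (p m) = 0.
    move=> ni; have [_ _ _ [fn1 fn2] fn0] := fP n.
    have [_ /(_ m)[pmn|/fn0//]] := rP n.
    suff /negbTE newn : ~~ new n by rewrite pmn fn1 fn2 /height /slope newn.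
    have ltin : (i < n)%N by rewrite ltn_neqAle eq_sym ni i_min// pmn.
    by apply/forallPn; exists (Ordinal ltin); rewrite /= negbK pim pmn.
  have [_ _ _ [fi1 fi2] _] := fP i.
  exists i; split=> //.
    rewrite /F (bigD1 (Ordinal iN))//= big1 ?addr0 -?pim// => n ni.
    by have [] := f_other n ni.
  rewrite /G (bigD1 (Ordinal iN))//= big1 ?addr0 -?pim// => n ni.
  by have [] := f_other n ni.
exists F; split.
- by move=> x; have [] := dF x.
- rewrite FG; apply: locally_lipschitz_local => x; exists 1 => //.
  exists (fun y => \sum_(n < N (x + 1)) (f n).2 y).
    by apply: (locally_lipschitz_sum (f := fun n => (f n).2)) => n; have [] := fP n.
  move=> y; rewrite ltr_norml => /andP[xy _].
  by have [] := FGE (x + 1) y; first by lra.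
- by move=> x; apply: sumr_ge0 => n _; have [] := fP n.
- move=> m; have [i [pim -> _ newi]] := value m.
  by rewrite /height newi pim (le_trans (ler_norm _))// lerDl.
- move=> m; rewrite FG; have [i [pim _ -> newi]] := value m.
  by rewrite /slope newi pim.
Unshelve. all: by end_near. Qed.

(** * Limits of sequences and the trajectory of the method *)

Lemma increasing_unbounded_cvgy (R : realType) (u : nat -> R) :
  increasing_seq u -> ~ bounded_set (range u) -> u @ \oo --> +oo.
Proof.
move=> u_incr u_unbounded; apply: nondecreasing_dvgn_lt.
  by move=> m n mn; rewrite u_incr.
move=> /cvg_seq_bounded [M [Mr uM]]; apply: u_unbounded; exists M; split=> //.
by move=> N MN _ [n _ <-]; exact: (uM N MN n).
Qed.

(** For each [N], some tail of [w] takes only values of [u] at indices from [N] on, so its infimum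
    is at least that of the tail of [u] from [N]. *)
Lemma le_limn_einf_reindex (R : realType) (u w : nat -> \bar R) :
  (forall N, \forall k \near \oo, exists2 j, (N <= j)%N & w k = u j) ->
  (limn_einf u <= limn_einf w)%E.
Proof.
move=> wu; rewrite !limn_einf_lim; apply: lime_le; first exact: is_cvg_einfs.
near=> N; have [K _ Kwu] := wu N.
apply: (@le_trans _ _ (einfs w K)).
  apply: le_ereal_inf_tmp => _ [k /= Kk <-]; have [j Nj ->] := Kwu k Kk.
  by apply: ereal_inf_lbound; exists j.
apply: lime_ge; first exact: is_cvg_einfs.
by near=> k; apply: nondecreasing_einfs; near: k; exists K.
Unshelve. all: by end_near. Qed.

(** Agreement is asked only along the trajectory of [h], so knowing the derivative of [F] at the
    prescribed points [psi k] suffices. *)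
Lemma eq_offo_seq (R : realType) (m : nat) (A : offo_model R m) s0 g h :
  (forall k, let psi := ancillary (offo_seq A s0 h k) in g k psi = h k psi) ->
  offo_seq A s0 g =1 offo_seq A s0 h.
Proof. by move=> gh; elim=> [//|k IHk] /=; rewrite IHk gh. Qed.

Theorem proposition1 (R : realType) (m : nat) (m_gt0 : (0 < m)%N)
    (theta0 psi0 : R) (mu0 : 'rV[R]_m) (A : offo_model R m)
    (condA : condition_A A) (condB : condition_B A theta0 psi0 mu0)
    (d' : nat -> R) (d'P : condition_B_witness A theta0 psi0 mu0 d') :
  exists F : R -> R,
    [/\ (forall x : R, derivable F x 1),
        continuous F,
        has_lbound (range F),
        locally_lipschitz F^`()%classic &
        let theta k :=
          iterate (offo_seq A (OffoState theta0 psi0 mu0)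
                     (fun _ psi => F^`()%classic psi) k) in
        limn_einf (fun k => (F (theta k))%:E) = +oo%E /\
        (limn_einf (fun k => `|d' k|%:E) <=
           limn_einf (fun k => `|F^`()%classic (theta k)|%:E))%E].
Proof.
case: d'P; set s := offo_seq _ _ _ => theta_incr theta_unb psi_incr psi_unb.
pose theta k := iterate (s k); pose psi k := ancillary (s k).
have theta_y : theta @ \oo --> +oo by exact: increasing_unbounded_cvgy.
have psi_y : psi @ \oo --> +oo by exact: increasing_unbounded_cvgy.
(* Both sequences are interleaved: [theta] at even indices, [psi] at odd ones. *)
pose p n := if odd n then psi n./2 else theta n./2.
have p_y : p @ \oo --> +oo.
  apply/cvgryPgt => a.
  have /cvgryPgt/(_ a)[N1 _ aN1] := theta_y.
  have /cvgryPgt/(_ a)[N2 _ aN2] := psi_y.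
  exists (maxn N1 N2).*2 => // n /=; rewrite -geq_half_double geq_max.
  by rewrite /p => /andP[? ?]; case: ifP => _; [exact: aN2|exact: aN1].
(* Points [psi j] take precedence over points [theta j], and injectivity of [psi] makes the slope
   there unambiguous. Points of neither kind get the arbitrary slope 0. *)
have /choice[v vP] : forall x, exists v, (forall k, x = psi k -> v = d' k) /\
    (forall k, x = theta k -> exists2 j, x = theta j \/ x = psi j & v = d' j).
  move=> x; have [[j xj]|xpsi] := pselect (exists j, x = psi j).
    exists (d' j); split=> [k|k _]; last by exists j => //; right.
    by rewrite xj => /eqP; rewrite (inj_eq (inc_inj psi_incr)) => /eqP ->.
  have [[j xj]|xtheta] := pselect (exists j, x = theta j).
    exists (d' j); split=> [k xk|k _]; first by case: xpsi; exists k.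
    by exists j => //; left.
  exists 0; split=> k xk; first by case: xpsi; exists k.
  by case: xtheta; exists k.
have [F [dF F'lip F_ge0 F_ge F'v]] := exists_smooth_interpolation v p_y.
have F'psi k : F^`()%classic (psi k) = d' k.
  have := F'v k.*2.+1; rewrite /p /= odd_double /= uphalf_double => ->.
  by have [/(_ k erefl)] := vP (psi k).
have p_theta k : p k.*2 = theta k by rewrite /p odd_double doubleK.
exists F; split => //.
- by move=> x; exact/differentiable_continuous/derivable1_diffP.
- by exists 0 => _ [x _ <-].
have -> : offo_seq A (OffoState theta0 psi0 mu0)
    (fun _ psi => F^`()%classic psi) = s.
  by apply/funext/eq_offo_seq => k /=; exact: F'psi.
split.
  (* [F (theta k)] is at least [theta k], which tends to infinity. *)
  rewrite (cvg_limn_einf_sup (l := +oo%E) _).1//; apply/cvgeryP/cvgryPgt => a.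
  have /cvgryPgt/(_ a) := theta_y; apply: filterS => k /lt_le_trans; apply.
  by have := F_ge k.*2; rewrite p_theta.
apply: le_limn_einf_reindex => N.
(* Once [psi N < theta k], an equality [theta k = psi j] forces [N <= j]; in the other case [j = k],
   and [N <= k] is imposed directly. *)
have /cvgryPgt/(_ (psi N))[K _ psiK] := theta_y.
exists (maxn K N) => // k /=; rewrite geq_max => /andP[Kk Nk].
have [_ /(_ k erefl)[j thetaj vj]] := vP (theta k).
exists j; last by rewrite -[iterate _]p_theta F'v p_theta vj.
case: thetaj => [/eqP|thetaj].
  by rewrite (inj_eq (inc_inj theta_incr)) => /eqP <-.
by have := psiK _ Kk; rewrite /= thetaj => /ltW; rewrite psi_incr.
Qed.
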